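(* Let $\mathfrak{A}$ be a unital $C^*$-algebra, $a\in\mathfrak{A}$ a nonzero positive element, $t,s\ge 0$ real numbers with $t+s>0$, and let $x\in\mathfrak{A}_a$. Then $$ts\left\|xx^{\sharp_a}+x^{\sharp_a}x\right\|_a+\frac12\sup_{\theta\in\mathbb{R}}\left|\left\|\mathfrak{R}_{(t,s)}(e^{i\theta}x)\right\|_a^2-\left\|\mathfrak{I}_{(t,s)}(e^{i\theta}x)\right\|_a^2\right|\le v_{(a,(t,s))}^2(x).$$
   Context: $\mathcal{S}(\mathfrak{A})$ is the set of states of $\mathfrak{A}$ and $\mathcal{S}_a(\mathfrak{A})=\{f/f(a): f\in\mathcal{S}(\mathfrak{A}),\ f(a)\ne 0\}$. For $x\in\mathfrak{A}$, $\|x\|_a=\sup\{\sqrt{f(x^*ax)}: f\in\mathcal{S}_a(\mathfrak{A})\}\in[0,\infty]$. An element $x^{\sharp_a}\in\mathfrak{A}$ is an $a$-adjoint of $x$ if $ax^{\sharp_a}=x^*a$; $\mathfrak{A}_a$ is the set of all elements of $\mathfrak{A}$ admitting an $a$-adjoint (a subalgebra of $\mathfrak{A}$ on which $\|\cdot\|_a$ is a finite semi-norm). $a$-adjoints need not be unique; $x^{\sharp_a}$ denotes an $a$-adjoint of $x$, with $(\lambda x)^{\sharp_a}=\overline{\lambda}x^{\sharp_a}$ for $\lambda\in\mathbb{C}$; the quantities in the claim do not depend on the choice. For $x\in\mathfrak{A}_a$ put $\mathfrak{R}_{(t,s)}(x)=tx+sx^{\sharp_a}$, $\mathfrak{I}_{(t,s)}(x)=t(-ix)+s(-ix)^{\sharp_a}$,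 and $v_{(a,(t,s))}(x)=\sup_{\theta\in\mathbb{R}}\|\mathfrak{R}_{(t,s)}(e^{i\theta}x)\|_a$; $v_{(a,(t,s))}^2(x)$ means $(v_{(a,(t,s))}(x))^2$. *)

(* Defs.v *)
From HB Require Import structures.
From mathcomp Require Import all_boot all_order all_algebra.
From mathcomp Require Import complex.
From mathcomp Require Import all_classical all_reals all_analysis.
Set Implicit Arguments.
Unset Strict Implicit.
Unset Printing Implicit Defensive.
Import Order.TTheory GRing.Theory Num.Theory.
Import numFieldNormedType.Exports.
Local Open Scope classical_set_scope.
Local Open Scope complex_scope.
Local Open Scope ring_scope.

(* MathComp's hierarchy has no common extension of [GRing.Algebra] and
   [NormedModule] (a join with the latter clashes with [Num.NumDomain]), so the
   norm, its completeness and the involution are added to [GRing.Algebra]. *)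
HB.mixin Record isCStarAlgebra (R : realType) (A : Type)
    of GRing.Algebra R[i] A := {
  cnorm : A -> R ;
  star : A -> A ;
  cnorm_eq0 : forall x : A, cnorm x = 0 -> x = 0 ;
  cnormD : forall x y : A, cnorm (x + y) <= cnorm x + cnorm y ;
  cnormZ : forall (l : R[i]) (x : A), cnorm (l *: x) = complex.Re `|l| * cnorm x ;
  cnormM : forall x y : A, cnorm (x * y) <= cnorm x * cnorm y ;
  cnorm_complete : forall u : nat -> A,
    (forall e : R, 0 < e -> exists N : nat, forall m n : nat,
       (N <= m)%N -> (N <= n)%N -> cnorm (u m - u n) < e) ->
    exists l : A, cnorm (u n - l) @[n --> \oo] --> (0 : R) ;
  starD : forall x y : A, star (x + y) = star x + star y ;
  starZ : forall (l : R[i]) (x : A), star (l *: x) = Num.conj l *: star x ;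
  starM : forall x y : A, star (x * y) = star y * star x ;
  starK : forall x : A, star (star x) = x ;
  cstar_norm : forall x : A, cnorm (star x * x) = cnorm x ^+ 2
}.

#[short(type="cstarAlgType")]
HB.structure Definition CStarAlgebra (R : realType) :=
  {A of GRing.Algebra R[i] A & isCStarAlgebra R A}.

Definition expi (R : realType) (theta : R) : R[i] :=
  cos theta +i* sin theta.

Section CStar.
Variables (R : realType) (A : cstarAlgType R).
Implicit Types (a x y : A) (sharp : A -> A) (t s : R).

Definition positive a : Prop := exists b : A, a = star b * b.

(* [`|f x|] is an element of R[i], hence the real part. *)
Definition functional_norm (f : A -> R[i]) : \bar R :=
  ereal_sup [set (complex.Re `|f x|)%:E | x in [set x : A | cnorm x <= 1]].

Definition is_state (f : {scalar A}) : Prop :=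
  (forall b : A, positive b -> 0 <= (f b : R[i])) /\ functional_norm f = 1%E.

Definition states_at a : set (A -> R[i]) :=
  [set g | exists f : {scalar A},
     [/\ is_state f, f a != 0 & g = fun x => f x / f a]].

(* For a positive, g (x^* a x) is a nonnegative real, so that taking its real
   part loses nothing. *)
Definition anorm a x : \bar R :=
  ereal_sup [set (Num.sqrt (complex.Re (g (star x * a * x))))%:E
            | g in states_at a].

Definition is_adjoint_wrt a x y : Prop := a * y = star x * a.

Definition has_adjoint_wrt a : set A :=
  [set x | exists y, is_adjoint_wrt a x y].

(* [sharp] selects one a-adjoint of each element that has some, in a
   conjugate-homogeneous way; its values elsewhere are irrelevant. *)
Definition adjoint_choice a sharp : Prop :=
  (forall x, has_adjoint_wrt a x -> is_adjoint_wrt a x (sharp x)) /\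
  (forall (l : R[i]) x, has_adjoint_wrt a x ->
     sharp (l *: x) = Num.conj l *: sharp x).

Definition Rts t s sharp x : A := t%:C *: x + s%:C *: sharp x.

Definition Its t s sharp x : A :=
  t%:C *: (- 'i *: x) + s%:C *: sharp (- 'i *: x).

Definition vats a t s sharp x : \bar R :=
  ereal_sup [set anorm a (Rts t s sharp (expi theta *: x))
            | theta in [set: R]].

Lemma adjoint_wrtZ a x y (l : R[i]) :
  is_adjoint_wrt a x y -> is_adjoint_wrt a (l *: x) (Num.conj l *: y).
Proof.
by rewrite /is_adjoint_wrt => axy; rewrite starZ -scalerAr axy scalerAl.
Qed.

Lemma adjoint_choice_exists a : exists sharp, adjoint_choice a sharp.
Proof.
pose ray x : set A := [set w | exists2 l : R[i], l != 0 & w = l *: x].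
pose rep x := xget 0 (ray x).
have rayZ (l : R[i]) x : l != 0 -> ray (l *: x) = ray x.
  move=> l0; apply/seteqP; split=> w [m m0 ->].
    by exists (m * l); rewrite ?mulf_neq0// scalerA.
  by exists (m / l); rewrite ?mulf_neq0 ?invr_eq0// scalerA divfK.
have repP x : exists2 l : R[i], l != 0 & x = l *: rep x.
  have [m m0 e] : ray x (rep x).
    by apply: (@xgetI _ _ _ x); exists 1; rewrite ?oner_neq0// scale1r.
  by exists m^-1; rewrite ?invr_eq0// e scalerA mulVf// scale1r.
pose co x : R[i] := xget 0 [set l | l != 0 /\ x = l *: rep x].
have coP x : co x != 0 /\ x = co x *: rep x.
  have [l l0 e] := repP x; exact: (@xgetI _ _ [set l | _] l (conj l0 e)).
pose adj x := xget 0 [set y | is_adjoint_wrt a x y].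
exists (fun x => if x == 0 then 0 else Num.conj (co x) *: adj (rep x)).
have hasZ (l : R[i]) x : has_adjoint_wrt a x -> has_adjoint_wrt a (l *: x).
  by move=> [y axy]; exists (Num.conj l *: y); exact: adjoint_wrtZ.
split=> [x xa|l x xa].
  have [->|x0] := eqVneq x 0.
    by rewrite /is_adjoint_wrt -(scale0r 0) starZ rmorph0 !scale0r mulr0 mul0r.
  have [c0 e] := coP x.
  rewrite {1}e; apply: adjoint_wrtZ.
  have [y ry] : has_adjoint_wrt a (rep x).
    have -> : rep x = (co x)^-1 *: x by rewrite {3}e scalerA mulVf// scale1r.
    exact: hasZ.
  exact: (@xgetI _ _ [set y | _] y ry).
rewrite scaler_eq0; have [->|l0] := eqVneq l 0.
  by rewrite rmorph0 scale0r.
have [->|x0 /=] := eqVneq x 0; first by rewrite scaler0.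
have repE : rep (l *: x) = rep x by rewrite /rep rayZ.
rewrite repE scalerA -rmorphM; congr (Num.conj _ *: _).
have [_ e] := coP x; have [_] := coP (l *: x).
rewrite repE {1}e scalerA => /eqP; rewrite -subr_eq0 -scalerBl scaler_eq0.
case/orP => [|/eqP r0]; first by rewrite subr_eq0 => /eqP.
by move: x0; rewrite e r0 scaler0 eqxx.
Qed.

End CStar.

(* Main.v *)
Require Import Defs.
From HB Require Import structures.
From mathcomp Require Import all_boot all_order all_algebra.
From mathcomp Require Import complex ring lra.
From mathcomp Require Import all_classical all_reals all_analysis.
Set Implicit Arguments.
Unset Strict Implicit.
Unset Printing Implicit Defensive.
Import Order.TTheory GRing.Theory Num.Theory.
Import numFieldNormedType.Exports.
Local Open Scope classical_set_scope.
Local Open Scope ring_scope.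

(* For a state f, <u,v> = Re f(u^* a v) is a real semi-inner product on A, for
   which left multiplications by X and by an a-adjoint Y of X are adjoint.
   Compressing f to f(u^* . u)/f(u^* u), again a state, shows that ||z||_a <= r
   means <zu,zu> <= r^2 <u,u> for all u and f.  The a-adjoint of z then obeys
   the same bound.  With X = e^(i theta) x, the elements R = tX + sY and
   I = -i(tX - sY), of a-seminorms r and q, satisfy with their a-adjoints
     |Ru|^2 + |Iu|^2 = 2(t^2 |Xu|^2 + s^2 |Yu|^2),
     |R'u|^2 + |I'u|^2 = 2(t^2 |Yu|^2 + s^2 |Xu|^2),
   so |Xu|^2 + |Yu|^2 <= K |u|^2 with K = (r^2 + q^2)/(t^2 + s^2).  The left
   side is <u,Tu> for T = XY + YX, hence ||T||_a <= K by Cauchy-Schwarz and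
   ts ||T||_a <= (r^2 + q^2)/2.  Adding |r^2 - q^2|/2 gives max(r^2, q^2), which
   is at most v^2 because the I at theta is the R at theta - pi/2. *)

(** * Real semi-inner products and operators adjoint for them *)

Section RealForm.
Local Open Scope complex_scope.
Variables (R : realType) (A : algType R[i]).

Definition real_form (B : A -> A -> R) : Prop :=
  [/\ forall u v, B u v = B v u,
      forall u v w, B (u + v) w = B u w + B v w,
      forall (c : R) u v, B (c%:C *: u) v = c * B u v &
      forall u, 0 <= B u u].

Lemma real_form_CS (B : A -> A -> R) (u v : A) :
  real_form B -> B u v ^+ 2 <= B u u * B v v.
Proof.
case=> BC BD BZ B0.
have BDr z w w' : B z (w + w') = B z w + B z w' by rewrite BC BD !(BC z).
have BZr (c : R) z w : B z (c%:C *: w) = c * B z w by rewrite BC BZ BC.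
have quad (c d : R) :
    0 <= c ^+ 2 * B u u + 2 * c * d * B u v + d ^+ 2 * B v v.
  have := B0 (c%:C *: u + d%:C *: v).
  rewrite BD !BDr !BZ !BZr (BC v u).
  by move: (B u u) (B u v) (B v v) => uu uv vv; nra.
(* These two pairs settle the cases [0 < B v v] and [0 < B u u]; the pairs (1, 1) and (1, -1) force
   [B u v = 0] when [u] and [v] are both isotropic. *)
have := quad (B v v) (- B u v); have := quad (- B u v) (B u u).
have := quad 1 1; have := quad 1 (-1).
move: (B0 u) (B0 v); rewrite le_eqVlt => /predU1P[<-|u0].
  rewrite le_eqVlt => /predU1P[<-|v0]; first by nra.
  by move=> _ _ _ q; rewrite -(ler_pM2l v0); nra.
by move=> _ _ _ q _; rewrite -(ler_pM2l u0); nra.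
Qed.

(** With |w|^2 for [B w w], Cauchy-Schwarz gives |Qu|^4 = B(PQu, u)^2 <= |PQu|^2 |u|^2 <= k |Qu|^2
    |u|^2, and |Qu|^2 cancels. *)
Lemma real_form_adjoint_bound (B : A -> A -> R) (P Q : A) (k : R) :
  real_form B ->
  (forall u w, B (P * u) w = B u (Q * w)) ->
  (forall u, B (P * u) (P * u) <= k * B u u) ->
  forall u, B (Q * u) (Q * u) <= k * B u u.
Proof.
move=> rB adj bnd u; have [_ _ _ B0] := rB.
have := B0 (Q * u); rewrite le_eqVlt => /predU1P[<-|p0].
  exact: le_trans (bnd u).
rewrite -(ler_pM2l p0) -expr2 -[in leLHS]adj.
apply: le_trans (real_form_CS _ _ rB) _.
by rewrite [leRHS]mulrA [_ * k in leRHS]mulrC; apply: ler_wpM2r.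
Qed.

(** Here [r] and [q] stand for squared seminorms. The form [C] represented by T = XY + YX satisfies
    C(w, w) <= K |w|^2, so Cauchy-Schwarz for [C] gives |Tu|^4 = C(Tu, u)^2 <= K^2 |Tu|^2 |u|^2. *)
Lemma real_form_anticommutator_bound
    (B : A -> A -> R) (X Y : A) (t s r q : R) :
  real_form B -> 0 < t ^+ 2 + s ^+ 2 ->
  (forall u w, B (X * u) w = B u (Y * w)) ->
  (forall u, B ((t%:C *: X + s%:C *: Y) * u) ((t%:C *: X + s%:C *: Y) * u)
     <= r * B u u) ->
  (forall u, B ((t%:C *: X - s%:C *: Y) * u) ((t%:C *: X - s%:C *: Y) * u)
     <= q * B u u) ->
  forall u, B ((X * Y + Y * X) * u) ((X * Y + Y * X) * u)
     <= ((r + q) / (t ^+ 2 + s ^+ 2)) ^+ 2 * B u u.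
Proof.
move=> rB ts0 adj bR bI u; have [BC BD BZ B0] := rB.
set K := (r + q) / _.
have BDr z w w' : B z (w + w') = B z w + B z w' by rewrite BC BD !(BC z).
have BZr (c : R) z w : B z (c%:C *: w) = c * B z w by rewrite BC BZ BC.
have BN z w : B (- z) w = - B z w.
  by rewrite -[- z]scaleN1r -(rmorphN1 (real_complex R)) BZ mulN1r.
have BNr z w : B z (- w) = - B z w by rewrite BC BN BC.
have adj' z w : B (Y * z) w = B z (X * w) by rewrite BC -adj BC.
have adjR z w : B ((t%:C *: X + s%:C *: Y) * z) w =
    B z ((t%:C *: Y + s%:C *: X) * w).
  by rewrite !mulrDl -!scalerAl BD BDr !BZ !BZr adj adj'.
have adjI z w : B ((t%:C *: X - s%:C *: Y) * z) w =
    B z ((t%:C *: Y - s%:C *: X) * w).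
  by rewrite !mulrDl !mulNr -!scalerAl BD BDr BN BNr !BZ !BZr adj adj'.
have bR' := real_form_adjoint_bound rB adjR bR.
have bI' := real_form_adjoint_bound rB adjI bI.
(* In the sum of the four bounds the cross terms [B (X * w) (Y * w)] cancel and t^2 + s^2 factors
   out. *)
have bS w : B (X * w) (X * w) + B (Y * w) (Y * w) <= K * B w w.
  rewrite /K mulrAC ler_pdivlMr//.
  move: (bR w) (bI w) (bR' w) (bI' w).
  rewrite !mulrDl !mulNr -!scalerAl !BD !BDr !BN !BNr !BZ !BZr.
  rewrite (BC (Y * w) (X * w)).
  move: (B (X * w) (X * w)) (B (Y * w) (Y * w)) (B (X * w) (Y * w)) (B w w).
  by move=> xx yy xy ww; lra.
pose C z w := B (X * z) (X * w) + B (Y * z) (Y * w).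
have rC : real_form C.
  split=> [z w|z z' w|c z w|z].
  - by rewrite /C BC (BC (Y * z)).
  - by rewrite /C !mulrDr !BD addrACA.
  - by rewrite /C -!scalerAr !BZ mulrDr.
  - by rewrite addr_ge0.
set T := X * Y + Y * X.
have CE z w : C z w = B z (T * w).
  by rewrite /C adj adj' -BDr mulrDl -!mulrA addrC.
have := B0 (T * u); rewrite le_eqVlt => /predU1P[<-|p0].
  by rewrite mulr_ge0 ?sqr_ge0.
rewrite -(ler_pM2l p0) -expr2 -[in leLHS]CE.
apply: le_trans (real_form_CS _ _ rC) _.
have -> : B (T * u) (T * u) * (K ^+ 2 * B u u) =
  K * B (T * u) (T * u) * (K * B u u) by ring.
by have [_ _ _ C0] := rC; apply: ler_pM => //; exact: bS.
Qed.

End RealForm.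

(** * States of the algebra and their compressions *)

Section States.
Local Open Scope complex_scope.
Variables (R : realType) (A : cstarAlgType R).
Implicit Types (a b u v x y z : A) (f : {scalar A}).

Lemma star1 : star (1 : A) = 1.
Proof. by rewrite -[LHS]mul1r -[X in X * _]starK -starM mul1r starK. Qed.

Lemma cnorm1 : cnorm (1 : A) = 1.
Proof.
have /eqP := cstar_norm (1 : A); rewrite star1 mul1r expr2 -subr_eq0.
rewrite -[X in X - _]mulr1 -mulrBr mulf_eq0 subr_eq0 => /orP[/eqP n0|/eqP //].
by have /eqP := cnorm_eq0 _ n0; rewrite oner_eq0.
Qed.

Lemma cnorm0 : cnorm (0 : A) = 0.
Proof. by rewrite -(scale0r (0 : A)) cnormZ normr0 mul0r. Qed.

Lemma cnorm_ge0 x : 0 <= cnorm x.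
Proof.
have := cnormD x (- x).
rewrite subrr cnorm0 -[- x]scaleN1r cnormZ normrN1 mul1r.
lra.
Qed.

Lemma cnormZr (c : R) x : 0 <= c -> cnorm (c%:C *: x) = c * cnorm x.
Proof. by move=> c0; rewrite cnormZ ger0_norm // ler0c. Qed.

Lemma Re_realM (c : R) (w : R[i]) : complex.Re (c%:C * w) = c * complex.Re w.
Proof. by case: w => p q /=; rewrite mul0r subr0. Qed.

Lemma ReD (w w' : R[i]) :
  complex.Re (w + w') = complex.Re w + complex.Re w'.
Proof. by case: w; case: w'. Qed.

Lemma ge0_Re (w : R[i]) : 0 <= w -> w = (complex.Re w)%:C.
Proof. by rewrite lecE => /andP[/eqP]; case: w => p q /= ->. Qed.

Definition positive_functional f : Prop :=
  forall b, positive b -> 0 <= (f b : R[i]).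

(** Positivity makes [f] real at w^* w for w = 1 + iz; the imaginary part of the expansion is the
    difference of the two sides. *)
Lemma Re_functional_star f z :
  positive_functional f -> complex.Re (f (star z)) = complex.Re (f z).
Proof.
move=> fpos.
have posM w : 0 <= (f (star w * w) : R[i]) by apply: fpos; exists w.
have := posM (1 + 'i%C *: z); have := posM 1; have := posM z.
rewrite starD starZ star1 mulrDl !mulrDr !mul1r !mulr1.
rewrite -scalerAl -scalerAr !linearD !linearZ /=.
rewrite !lecE => /andP[/eqP i1 _] /andP[/eqP i2 _] /andP[/eqP + _].
case: (f (star z * z)) i1 => p q /= ->.
case: (f 1) i2 => p' q' /= ->.
by case: (f (star z)) => c d; case: (f z) => c' d' /=; lra.
Qed.

Definition functional_form f a u v : R := complex.Re (f (star u * a * v)).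

Lemma functional_form_real_form f a :
  positive_functional f -> positive a -> real_form (functional_form f a).
Proof.
move=> fpos [b ->]; split=> [u v|u v w|c u v|u]; rewrite /functional_form.
- rewrite -Re_functional_star//; congr (complex.Re (f _)).
  by rewrite !starM !starK !mulrA.
- by rewrite starD !mulrDl linearD ReD.
- rewrite starZ -!scalerAl linearZ /= -Re_realM; congr (complex.Re (_ * _)).
  exact: conjc_real.
- rewrite mulrA -starM -mulrA.
  have : 0 <= (f (star (b * u) * (b * u)) : R[i]).
    by apply: fpos; exists (b * u).
  by rewrite lecE => /andP[].
Qed.

Section Compression.
Variables (f : {scalar A}) (u : A).

(** In the GNS representation of a state [f] this is the vector state of the normalised class of
    [u]; it is zero when [f (star u * u)] is. *)
Definition compression z : R[i] := f (star u * z * u) / f (star u * u).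

Fact compression_is_linear : scalar compression.
Proof.
move=> c y z; rewrite /compression mulrDr mulrDl -scalerAr -scalerAl.
by rewrite linearP /= mulrDl mulrA.
Qed.

HB.instance Definition _ :=
  GRing.isLinear.Build R[i] A R[i] *%R compression compression_is_linear.

End Compression.

Lemma Re_le_norm (w : R[i]) : complex.Re w <= complex.Re `|w|.
Proof.
apply: le_trans (ler_norm _) _.
by have := normc_ge_Re w; rewrite lecE => /andP[].
Qed.

Lemma positive1 : positive (1 : A).
Proof. by exists 1; rewrite star1 mul1r. Qed.

Lemma functional_form1 f u v :
  functional_form f 1 u v = complex.Re (f (star u * v)).
Proof. by rewrite /functional_form mulr1. Qed.

Lemma state_Re_le1 f z :
  is_state f -> cnorm z <= 1 -> complex.Re (f z) <= 1.
Proof.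
case=> _ fn z1; apply: le_trans (Re_le_norm _) _.
by rewrite -lee_fin -fn; apply: ereal_sup_ubound; exists z.
Qed.

(* With S the supremum of Re f(u^* z u) over the unit ball, Cauchy-Schwarz gives
   S^2 <= f(u^* u) S, so no square root of 1 - z^* z is needed. *)
Lemma Re_compression_le f u z :
  is_state f -> cnorm z <= 1 ->
  complex.Re (f (star u * z * u)) <= complex.Re (f (star u * u)).
Proof.
move=> fs; have [fpos _] := fs.
set c := complex.Re (f (star u * u)).
pose phi w := complex.Re (f (star u * w * u)).
pose E := [set phi w | w in [set w | cnorm w <= 1]].
have rf := functional_form_real_form fpos positive1.
(* A crude bound for [phi] on the unit ball, which makes [sup E] meaningful; the added 1 keeps [d]
   positive for the division. *)
pose d := cnorm (star u) * cnorm u + 1.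
have d0 : 0 < d by rewrite ltr_wpDl// mulr_ge0// cnorm_ge0.
have phid w : cnorm w <= 1 -> phi w <= d.
  move=> w1; rewrite -[leRHS]mulr1 mulrC -ler_pdivrMr// mulrC -Re_realM.
  have -> : (d^-1)%:C * f (star u * w * u) = f ((d^-1)%:C *: (star u * w * u)).
    by rewrite linearZ.
  apply: state_Re_le1 => //; rewrite cnormZr ?invr_ge0 ?(ltW d0)//.
  rewrite ler_pdivrMl// mulr1.
  apply: le_trans (cnormM _ _) _.
  rewrite /d -[leLHS]addr0 lerD// ler_wpM2r ?cnorm_ge0//.
  by apply: le_trans (cnormM _ _) _; rewrite ler_piMr ?cnorm_ge0.
have E_ub : has_ubound E by exists d => _ [w w1 <-]; exact: phid.
have leS w : cnorm w <= 1 -> phi w <= sup E.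
  by move=> w1; apply: ub_le_sup => //; exists w.
have c0 : 0 <= c by rewrite /c -functional_form1; have [_ _ _] := rf.
have phi1 : phi 1 = c by rewrite /phi mulr1.
have cS : c <= sup E by rewrite -phi1; apply: leS; rewrite cnorm1.
(* This rearranges to [sup E <= c]. It follows from phi(w)^2 <= c phi(w^* w) <= c S by the
   arithmetic-geometric mean inequality. *)
suff : sup E <= (c + sup E) / 2.
  by move=> h z1; apply: le_trans (leS z z1) _; move: h; lra.
apply: ge_sup; first by exists c, 1 => //=; rewrite cnorm1.
move=> _ [w w1 <-].
have := real_form_CS u (w * u) rf; rewrite !functional_form1 -/c.
rewrite (mulrA _ w) -/(phi w) starM -!mulrA (mulrA (star w)) mulrA -/(phi _).
have : phi (star w * w) <= sup E.
  by apply: leS; rewrite cstar_norm expr_le1// cnorm_ge0.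
move: (phi _) (phi w) (sup E) cS c0 => p q S; nra.
Qed.

Lemma compression_state f u :
  is_state f -> f (star u * u) != 0 -> is_state (compression f u).
Proof.
move=> fs; have [fpos _] := fs => n0.
have c0 : 0 <= (f (star u * u) : R[i]) by apply: fpos; exists u.
have cpos : 0 < complex.Re (f (star u * u)).
  rewrite lt_def; have := c0; rewrite lecE => /andP[_ ->]; rewrite andbT.
  by apply: contra_neq n0 => e; rewrite (ge0_Re c0) e.
have Rec w : complex.Re (compression f u w) =
    (complex.Re (f (star u * u)))^-1 * complex.Re (f (star u * w * u)).
  by rewrite /compression {1}(ge0_Re c0) -fmorphV mulrC Re_realM.
have le1 w : cnorm w <= 1 -> complex.Re (compression f u w) <= 1.
  move=> w1; rewrite Rec mulrC ler_pdivrMr// mul1r.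
  exact: Re_compression_le.
split.
  move=> _ [b ->]; apply: divr_ge0 => //.
  by apply: fpos; exists (b * u); rewrite starM !mulrA.
apply/eqP; rewrite eq_le; apply/andP; split.
  apply: ge_ereal_sup => _ [w /= w1 <-]; rewrite lee_fin.
  change (complex.Re `|compression f u w| <= 1).
  have [->|cw0] := eqVneq (compression f u w) 0; first by rewrite normr0 ler01.
  set W := compression f u w in cw0 *.
  (* The unimodular phase [l] rotates [W] onto its modulus, so the bound on real parts also bounds
     the modulus. *)
  pose l := `|W| / W.
  have -> : `|W| = compression f u (l *: w).
    by rewrite [RHS]linearZ /= -/W /l divfK.
  apply: le1; rewrite cnormZ.
  by rewrite /l normf_div normr_id divff ?normr_eq0// mul1r.
apply: ereal_sup_ubound; exists 1 => /=; first by rewrite cnorm1.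
change ((complex.Re `|compression f u 1|)%:E = 1%E).
by rewrite /compression mulr1 divff// normr1.
Qed.

(** The supremum defining [anorm] only evaluates states at z^* a z; on [compression f u] this
    becomes the bound at the vector [u], since the factors f(u^* u) cancel. *)
Lemma anorm_form_bound f a z y (r : R) u :
  is_state f -> positive a -> is_adjoint_wrt a z y -> 0 <= r ->
  (anorm a z <= r%:E)%E ->
  functional_form f a (z * u) (z * u) <= r ^+ 2 * functional_form f a u u.
Proof.
move=> fs apos azy r0 zr; have [fpos _] := fs.
have rf := functional_form_real_form fpos apos.
have rf1 := functional_form_real_form fpos positive1.
have [_ _ _ rf0] := rf.
have fua0 : 0 <= (f (star u * a * u) : R[i]).
  have [b ->] := apos; apply: fpos; exists (b * u).
  by rewrite starM !mulrA.
(* When <u, u> = 0 the compression cannot be normalised at [a]; instead <zu, zu> = <u, yzu> vanishes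
   by Cauchy-Schwarz. *)
have [e|n0] := eqVneq (functional_form f a u u) 0.
  rewrite e mulr0.
  have := real_form_CS u (y * (z * u)) rf; rewrite e mul0r.
  have -> : functional_form f a (z * u) (z * u) =
      functional_form f a u (y * (z * u)).
    rewrite /functional_form starM -[X in f (X * _)]mulrA -azy.
    by rewrite !mulrA.
  by move: (functional_form _ _ _ _) => p; nra.
have m0 : f (star u * a * u) != 0.
  by apply: contra_neq n0; rewrite /functional_form => ->.
(* Cauchy-Schwarz for Re f(u^* v), applied to u and au, shows that f(u^* u) = 0 would force <u, u> =
   0. *)
have k0 : f (star u * u) != 0.
  apply: contra_neq n0 => e.
  have := real_form_CS u (a * u) rf1; rewrite !functional_form1 e mul0r mulrA.
  rewrite /functional_form; move: (complex.Re (f _)) => p.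
  by move=> h; apply/eqP; rewrite -sqrf_eq0 eq_le h sqr_ge0.
pose g w := compression f u w / compression f u a.
have gs : states_at a g.
  exists (compression f u); split => //; first exact: compression_state.
  by rewrite /= /compression mulf_neq0// invr_eq0.
have : ((Num.sqrt (complex.Re
    (compression f u (star z * a * z) / compression f u a)))%:E <= r%:E)%E.
  by apply: le_trans zr; apply: ereal_sup_ubound; exists g.
rewrite lee_fin.
have -> : compression f u (star z * a * z) / compression f u a =
   f (star u * (star z * a * z) * u) / f (star u * a * u).
  by rewrite /compression invf_div [LHS]mulrA divfK.
rewrite -(ler_pXn2r (ltn0Sn 1)) ?nnegrE ?sqrtr_ge0//.
rewrite {1}(ge0_Re fua0) -fmorphV [X in complex.Re X]mulrC Re_realM.
have upos : 0 < functional_form f a u u.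
  by rewrite lt_def n0 rf0.
have -> : complex.Re (f (star u * (star z * a * z) * u)) =
  functional_form f a (z * u) (z * u).
  by rewrite /functional_form starM !mulrA.
rewrite -/(functional_form f a u u) sqr_sqrtr; last first.
  by rewrite mulr_ge0 ?invr_ge0 ?(ltW upos).
by rewrite mulrC ler_pdivrMr.
Qed.

End States.

(** * The a-seminorm of the anticommutator *)

Section Anticommutator.
Local Open Scope complex_scope.
Variables (R : realType) (A : cstarAlgType R).
Implicit Types (a x y z X Y : A) (sharp : A -> A).

Lemma expiBpihalf (th : R) : expi (th - pi / 2) = - 'i%R * expi th.
Proof.
rewrite /expi cosBpihalf sinBpihalf -complexiE.
by apply/eqP; rewrite eq_complex /=; apply/andP; split; apply/eqP; ring.
Qed.

Lemma norm_expi (th : R) : `|expi th| = 1.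
Proof. by rewrite normc_def /= cos2Dsin2 sqrtr1. Qed.

Lemma positive_star a : positive a -> star a = a.
Proof. by case=> b ->; rewrite starM starK. Qed.

Lemma is_adjoint_wrt_sym a x y :
  positive a -> is_adjoint_wrt a x y -> is_adjoint_wrt a y x.
Proof.
rewrite /is_adjoint_wrt => /positive_star sa axy.
by rewrite -[in RHS]sa -starM axy starM starK sa.
Qed.

Lemma is_adjoint_wrtD a x y x' y' :
  is_adjoint_wrt a x y -> is_adjoint_wrt a x' y' ->
  is_adjoint_wrt a (x + x') (y + y').
Proof. by rewrite /is_adjoint_wrt mulrDr starD mulrDl => -> ->. Qed.

Lemma anormZ_unit a z (l : R[i]) : `|l| = 1 -> anorm a (l *: z) = anorm a z.
Proof.
move=> l1; rewrite /anorm; congr ereal_sup; apply: eq_imagel => g _.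
congr (Num.sqrt (complex.Re (g _)))%:E.
by rewrite starZ -!scalerAl -scalerAr scalerA -normCKC l1 expr1n scale1r.
Qed.

Lemma anorm_anticommutator a X Y (t s r q : R) :
  positive a -> 0 <= t -> 0 <= s -> 0 < t + s -> is_adjoint_wrt a X Y ->
  0 <= r -> 0 <= q ->
  (anorm a (t%:C *: X + s%:C *: Y)%R <= r%:E)%E ->
  (anorm a (t%:C *: X - s%:C *: Y)%R <= q%:E)%E ->
  ((t * s)%:E * anorm a (X * Y + Y * X)%R <= ((r ^+ 2 + q ^+ 2) / 2)%R%:E)%E.
Proof.
move=> apos t0 s0 ts0 aXY r0 q0 bR bI.
have aYX := is_adjoint_wrt_sym apos aXY.
have ts20 : 0 < t ^+ 2 + s ^+ 2.
  by have := exprn_gt0 2 ts0; have := sqr_ge0 (t - s); nra.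
set K := (r ^+ 2 + q ^+ 2) / (t ^+ 2 + s ^+ 2).
have K0 : 0 <= K by rewrite divr_ge0 ?addr_ge0 ?sqr_ge0.
have NK : (anorm a (X * Y + Y * X)%R <= K%:E)%E.
  apply: ge_ereal_sup => _ [_ [f [fs fa0 ->]] <-]; rewrite lee_fin.
  have [fpos _] := fs.
  have rf := functional_form_real_form fpos apos.
  have fa : 0 <= (f a : R[i]) by exact: fpos.
  have adj u w : functional_form f a (X * u) w = functional_form f a u (Y * w).
    by rewrite /functional_form starM -[X in f (X * _)]mulrA -aXY !mulrA.
  have adjZ (c : R) z w : is_adjoint_wrt a z w ->
      is_adjoint_wrt a (c%:C *: z) (c%:C *: w).
    move=> /(adjoint_wrtZ c%:C); rewrite (_ : Num.conj _ = c%:C)//.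
    exact: conjc_real.
  (* With the sign moved into the coefficient, tX - sY gets its a-adjoint in the same way as tX +
     sY. *)
  have sN : - (s%:C *: Y) = (- s)%:C *: Y by rewrite rmorphN scaleNr.
  have aR := is_adjoint_wrtD (adjZ t _ _ aXY) (adjZ s _ _ aYX).
  have aI := is_adjoint_wrtD (adjZ t _ _ aXY) (adjZ (- s) _ _ aYX).
  rewrite -sN in aI.
  (* At the vector 1 the form bound reads f(T^* a T) <= K^2 f(a), which bounds the quotient inside
     [anorm]. *)
  have := real_form_anticommutator_bound rf ts20 adj
    (fun u => anorm_form_bound u fs apos aR r0 bR)
    (fun u => anorm_form_bound u fs apos aI q0 bI) 1.
  rewrite -/K !mulr1 /functional_form star1 mul1r mulr1.
  set T := X * Y + Y * X => h.
  have fapos : 0 < complex.Re (f a).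
    rewrite lt_def; have := fa; rewrite lecE => /andP[_ ->]; rewrite andbT.
    by apply: contra_neq fa0 => e; rewrite (ge0_Re fa) e.
  rewrite -(ler_pXn2r (ltn0Sn 1)) ?nnegrE ?sqrtr_ge0//.
  rewrite {1}(ge0_Re fa) -fmorphV [X in complex.Re X]mulrC Re_realM.
  rewrite sqr_sqrtr; first by rewrite mulrC ler_pdivrMr.
  rewrite mulr_ge0 ?invr_ge0 ?(ltW fapos)//.
  by have [_ _ _ f0] := rf; have := f0 T.
apply: (@le_trans _ _ ((t * s)%:E * K%:E)%E).
  by apply: lee_wpmul2l => //; rewrite lee_fin mulr_ge0.
(* The denominator of [K] is absorbed by 2ts <= t^2 + s^2. *)
rewrite -EFinM lee_fin /K mulrA ler_pdivrMr//.
have : 0 <= (t - s) ^+ 2 by exact: sqr_ge0.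
have : 0 <= r ^+ 2 + q ^+ 2 by rewrite addr_ge0 ?sqr_ge0.
move: (r ^+ 2 + q ^+ 2) => k; nra.
Qed.

End Anticommutator.

(** * Passage to the supremum over the angle *)

Theorem theorem2p11 (R : realType) (A : cstarAlgType R) (a : A) (t s : R)
    (sharp : A -> A) (x : A) :
  a != 0 -> positive a -> 0 <= t -> 0 <= s -> 0 < t + s ->
  adjoint_choice a sharp -> has_adjoint_wrt a x ->
  ((t * s)%:E * anorm a (x * sharp x + sharp x * x)%R
   + (2^-1)%:E * ereal_sup
       [set `| anorm a (Rts t s sharp (expi theta *: x)) ^+ 2
             - anorm a (Its t s sharp (expi theta *: x)) ^+ 2 |
       | theta in [set: R]]
   <= vats a t s sharp x ^+ 2)%E.
Proof.
move=> _ apos t0 s0 ts0 [sharpP sharpZ] ax.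
have axZ (l : R[i]) : has_adjoint_wrt a (l *: x).
  by have [y axy] := ax; exists (Num.conj l *: y); exact: adjoint_wrtZ.
have ItsE th : Its t s sharp (expi th *: x) =
    Rts t s sharp (expi (th - pi / 2) *: x).
  by rewrite expiBpihalf -scalerA.
have Rle th : (anorm a (Rts t s sharp (expi th *: x)) <= vats a t s sharp x)%E.
  by apply: ereal_sup_ubound; exists th.
(* If the supremum is infinite (-oo when no state is nonzero at a), its square
   is +oo. *)
case E : (vats a t s sharp x) => [v| |]; rewrite expe2; last 2 first.
- by rewrite mulyy leey.
- by rewrite mulNyNy leey.
rewrite E in Rle.
(* Without such a state every [anorm] would be the supremum of the empty set, -oo, against the
   finiteness of [v]. *)
have [g0 sg0] : exists g, states_at a g.
  apply: contrapT => /forallNP s0g; suff : (v%:E <= -oo)%E by [].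
  rewrite -E; apply: ge_ereal_sup => _ [th _ <-].
  by apply: ge_ereal_sup => _ [g sg <-]; case: (s0g g).
have N0 z : (0 <= anorm a z)%E.
  apply: ereal_sup_ge; eexists; first by exists g0.
  by rewrite lee_fin sqrtr_ge0.
have RE th : exists r : R,
    [/\ anorm a (Rts t s sharp (expi th *: x)) = r%:E, 0 <= r & r <= v].
  have := Rle th; have := N0 (Rts t s sharp (expi th *: x)).
  by case: (anorm _ _) => // r r0 rv; exists r.
(* The left side is the same for every angle: rotating [x] by [l] rotates its a-adjoint by the
   conjugate, and l times its conjugate is 1. *)
have bound th r q :
    anorm a (Rts t s sharp (expi th *: x)) = r%:E -> 0 <= r ->
    anorm a (Its t s sharp (expi th *: x)) = q%:E -> 0 <= q ->
    ((t * s)%:E * anorm a (x * sharp x + sharp x * x)%R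
      <= ((r ^+ 2 + q ^+ 2) / 2)%R%:E)%E.
  move=> er r0 eq q0; set l := expi th in er eq *.
  have ll : l * Num.conj l = 1 by rewrite -normCK norm_expi expr1n.
  have := sharpP _ (axZ l); rewrite (sharpZ l _ ax) => adj.
  have -> : x * sharp x + sharp x * x =
      (l *: x) * (Num.conj l *: sharp x) + (Num.conj l *: sharp x) * (l *: x).
    by rewrite -!scalerAl -!scalerAr !scalerA [Num.conj l * l]mulrC ll !scale1r.
  have ItsE' : Its t s sharp (l *: x) = - 'i%R *:
      (t%:C%C *: (l *: x) - s%:C%C *: (Num.conj l *: sharp x)).
    rewrite /Its (sharpZ (- 'i%R) _ (axZ l)) (sharpZ l _ ax) rmorphN /= conjCi.
    rewrite opprK scalerBr -scaleNr !scalerA.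
    by congr (_ *: _ + _ *: _); ring.
  apply: anorm_anticommutator => //.
    by rewrite -(sharpZ l _ ax) -er.
  by rewrite -eq ItsE' anormZ_unit// normrN normCi.
(* A single angle already shows that the first summand is a finite number [n]. *)
have [r0 [er0 r00 _]] := RE 0; have [q0 [eq0 q00 _]] := RE (0 - pi / 2).
rewrite -ItsE in eq0.
have tsN0 : (0 <= (t * s)%:E * anorm a (x * sharp x + sharp x * x)%R)%E.
  by rewrite mule_ge0// lee_fin mulr_ge0.
have := bound 0 _ _ er0 r00 eq0 q00.
move: bound tsN0; case: ((t * s)%:E * _)%E => // n bound n0 _.
(* From 2n <= r^2 + q^2 and r, q <= v: r^2 - q^2 = 2r^2 - (r^2 + q^2) <= 2(v^2 - n), and likewise
   with r and q exchanged. *)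
have : (ereal_sup
       [set `| anorm a (Rts t s sharp (expi theta *: x)) ^+ 2
             - anorm a (Its t s sharp (expi theta *: x)) ^+ 2 |
       | theta in [set: R]] <= (2 * (v ^+ 2 - n))%:E)%E.
  apply: ge_ereal_sup => _ [th _ <-].
  have [r [er r0' rv]] := RE th; have [q [eq q0' qv]] := RE (th - pi / 2).
  rewrite -ItsE in eq.
  have := bound th _ _ er r0' eq q0'; rewrite er eq.
  rewrite -!EFin_expe -EFinB abse_EFin.
  rewrite !lee_fin => h.
  by rewrite ler_norml; apply/andP; split; nra.
move=> h.
apply: (@le_trans _ _ (n%:E + (2^-1)%:E * (2 * (v ^+ 2 - n))%:E)%E).
  by rewrite leeD2l// lee_wpmul2l.
by rewrite -!EFinM -EFinD lee_fin mulrA mulVf// mul1r addrC subrK expr2.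
Qed.
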